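(* Let $M\subset\mathbb{Z}[t_1,\dots,t_r]$ be an affine monoid of rank $r$. Then there exist generators $\{W_1,\dots,W_l\}\subset M$ of $M$ such that (1) $\{W_1,\dots,W_{2r'}\}$ generates the group of units $U(M)$, where $r'=\mathrm{rank}(U(M))$; (2) $W_i=W_{i+r'}^{-1}$ for $1\le i\le r'$; (3) $V=\mathbb{Z}_+[W_{2r'+1},\dots,W_l]$ is a positive monoid such that $V\setminus\{1\}\subset M\setminus U(M)$.
   Context: Here $\mathbb{Z}[t_1,\dots,t_r]\cong\mathbb{Z}^r$ denotes the free abelian group, written multiplicatively, of Laurent monomials in $t_1,\dots,t_r$, and $\mathbb{Z}_+[T]$ denotes the monoid generated multiplicatively by a set $T$. Affine means finitely generated; positive means having trivial group of units. The rank of a monoid is $\dim_{\mathbb{Q}}(\mathbb{Q}\otimes gp(M))$ where $gp(M)$ is its group completion. Generators are generators as a monoid. *)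

(* Defs.v *)
From HB Require Import structures.
From mathcomp Require Import all_boot all_order all_algebra.
From mathcomp Require Import boolp classical_sets.

Set Implicit Arguments.
Unset Strict Implicit.
Unset Printing Implicit Defensive.
Import GRing.Theory.
Local Open Scope classical_set_scope.
Local Open Scope ring_scope.

(* The group of Laurent monomials in t_1, ..., t_r is represented by the      *)
(* exponent vectors 'rV[int]_r. Products of monomials are sums of vectors,    *)
(* the monomial 1 is the vector 0, and W^-1 is - W.                           *)

Section Monoids.
Variable G : zmodType.
Implicit Types M T : set G.

Definition submonoid M : Prop := M 0 /\ forall x y, M x -> M y -> M (x + y).

Definition gen T : set G := smallest submonoid T.

Definition affine M : Prop :=
  submonoid M /\ exists s : seq G, M = gen [set` s].

Definition units M : set G := [set x | M x /\ M (- x)].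

Definition positive M : Prop := units M = [set 0].

(* Since M lies in a group, its group completion is the subgroup of           *)
(* differences of elements of M.                                              *)
Definition gp M : set G := [set x - y | x in M & y in M].

End Monoids.

Section Span.
Variables (F : fieldType) (vT : vectType F) (A : set vT).

Lemma span_set_ex : exists V : {vspace vT}, forall v,
  v \in V <-> exists2 s : seq vT, [set` s] `<=` A & v \in <<s>>%VS.
Proof.
pose P n := `[< exists2 s : seq vT, [set` s] `<=` A & \dim <<s>>%VS = n >].
have exP : exists n, P n by exists (\dim <<[::] : seq vT>>%VS); apply/asboolP; exists [::].
have ubP n : P n -> (n <= dim vT)%N.
  by move=> /asboolP[s _ <-]; rewrite -dimvf dimvS ?subvf.
case: (ex_maxnP exP ubP) => n /asboolP[s sA dims] maxn.
exists <<s>>%VS => v; split=> [vs|[s' s'A vs']]; first by exists s.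
have -> : <<s>>%VS = <<s ++ s'>>%VS.
  apply/eqP; rewrite eqEdim span_cat addvSl /= -span_cat dims.
  apply: maxn; apply/asboolP; exists (s ++ s') => //.
  by move=> x /=; rewrite mem_cat => /orP[/sA|/s'A].
by rewrite span_cat (subvP (addvSr _ _)).
Qed.

(* The linear span of an arbitrary (possibly infinite) set of vectors.        *)
Definition span_set : {vspace vT} := sval (cid span_set_ex).

Lemma mem_span_set v :
  v \in span_set <-> exists2 s : seq vT, [set` s] `<=` A & v \in <<s>>%VS.
Proof. exact: (svalP (cid span_set_ex)). Qed.

End Span.

(* By flatness of Q over Z, the space Q (x) gp(M) is identified with its      *)
(* image in Q (x) Z^r = Q^r, namely the Q-span of gp(M).                      *)
Definition rank (r : nat) (M : set 'rV[int]_r) : nat :=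
  \dim (span_set [set map_mx (intr : int -> rat) x | x in gp M]).

(* Main.v *)
(** A sum of elements of M is a unit only if every summand is, so U(M) is
    generated by those generators of M that are units, and the submonoid V
    generated by the others meets U(M) only in 1; hence V is positive. The
    subgroup U(M) of Z^r has a Z-basis of r' elements by the Smith normal
    form, and as a monoid it is generated by that basis and its inverses. *)
Require Import Defs.
From mathcomp Require Import all_boot all_order all_algebra.
From mathcomp Require Import boolp classical_sets.

Set Implicit Arguments.
Unset Strict Implicit.
Import GRing.Theory.
Local Open Scope classical_set_scope.
Local Open Scope ring_scope.

(** * Units and non-units of a generated monoid *)

Section Generation.
Variable G : zmodType.
Implicit Types (T A : set G) (M : set G).

Lemma submonoid_gen T : submonoid (gen T).
Proof.
split=> [A [[]]//|x y Tx Ty A AT].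
by case: (AT) => -[_ AD] _; apply: AD; [exact: Tx|exact: Ty].
Qed.

Lemma gen_ind T (P : G -> Prop) :
    P 0 -> (forall x y, P x -> P y -> P (x + y)) -> (forall x, T x -> P x) ->
  forall x, gen T x -> P x.
Proof. by move=> P0 PD TP x Tx; exact: (Tx P). Qed.

Lemma gen_sum T (I : finType) (F : I -> G) :
  (forall i, gen T (F i)) -> gen T (\sum_i F i).
Proof.
have [T0 TD] := submonoid_gen T.
by move=> TF; elim/big_ind: _.
Qed.

Lemma gen_symmetric T :
  (forall x, T x -> T (- x)) -> forall x, gen T x -> gen T (- x).
Proof.
move=> TN; have [T0 TD] := submonoid_gen T.
apply: gen_ind => [|x y Tx Ty|x /TN]; first by rewrite oppr0.
  by rewrite opprD; apply: TD.
exact: sub_gen_smallest.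
Qed.

(** The inverse of [x] is [y - (x + y)], a sum of two elements of [M]. *)
Lemma units_summand M x y :
  submonoid M -> M x -> M y -> units M (x + y) -> units M x.
Proof.
move=> [_ MD] Mx My [_ Mxy]; split=> //.
by have := MD _ _ My Mxy; rewrite opprD addrCA subrr addr0.
Qed.

Lemma submonoid_units M : submonoid M -> submonoid (units M).
Proof.
move=> [M0 MD]; split=> [|x y [Mx MNx] [My MNy]]; split; rewrite ?oppr0//.
  exact: MD.
by rewrite opprD; exact: MD.
Qed.

Lemma units_gen T : units (gen T) = gen (T `&` units (gen T)).
Proof.
have MT := submonoid_gen T; have [M0 MD] := MT.
set TU := T `&` _; have [U0 UD] := submonoid_gen TU.
apply/seteqP; split=> x; last first.
  by apply: smallest_sub x; [exact: submonoid_units|exact: subIsetr].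
move=> Ux; have [Mx _] := Ux; move: Mx Ux.
(* The induction carries membership in [gen T] along, because [units_summand] asks for it on both
   summands. *)
suff TP : forall x, gen T x -> gen T x /\ (units (gen T) x -> gen TU x).
  by move=> /TP[].
apply: gen_ind => [//|y z [My Uy] [Mz Uz]|y Ty]; last first.
  by split=> [|Uy]; apply: sub_gen_smallest.
split=> [|Uyz]; first exact: MD.
apply: UD; first exact: (Uy (units_summand MT My Mz Uyz)).
by rewrite addrC in Uyz; exact: (Uz (units_summand MT Mz My Uyz)).
Qed.

(** By induction, only 0 can be a unit of [gen T]: a generator is a non-unit by choice, and if a sum
    is a unit then both summands are, so both vanish. *)
Lemma gen_nonunits T :
  gen (T `\` units (gen T)) `\` [set 0] `<=` gen T `\` units (gen T).
Proof.
have MT := submonoid_gen T; have [M0 MD] := MT.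
suff TV : forall x, gen (T `\` units (gen T)) x ->
    gen T x /\ (units (gen T) x -> x = 0).
  by move=> x [/TV[Mx Ux] x0]; split=> // /Ux.
apply: gen_ind => [//|x y [Mx Ux] [My Uy]|x [Tx NUx]]; last first.
  by split=> //; exact: sub_gen_smallest.
split=> [|Uxy]; first exact: MD.
have /Ux-> := units_summand MT Mx My Uxy.
by rewrite addrC in Uxy; rewrite (Uy (units_summand MT My Mx Uxy)) addr0.
Qed.

(** If [x] were a nonzero unit of [V], then [x] and [- x] would both lie in [M], making [x] a unit
    of [M]. *)
Lemma positive_sub_nonunits V M :
  submonoid V -> V `\` [set 0] `<=` M `\` units M -> positive V.
Proof.
move=> [V0 _] VM; apply/seteqP; split=> [x [Vx VNx]|x ->]; last first.
  by split; rewrite ?oppr0.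
apply: contrapT => /= x0; have [Mx []] := VM _ (conj Vx x0); split=> //.
have [|//] := VM (- x).
by split=> //= /eqP; rewrite oppr_eq0 => /eqP.
Qed.

End Generation.

(** * Integer row combinations, rank and bases of subgroups *)

Lemma gen_scale r (T : set 'rV[int]_r) (a : int) (x : 'rV[int]_r) :
  (forall y, T y -> T (- y)) -> gen T x -> gen T (a *: x).
Proof.
move=> TN Tx; have [T0 TD] := submonoid_gen T.
have Tn n : gen T (x *+ n).
  by elim: n => [|n IH]; rewrite ?mulr0n// mulrS; apply: TD.
rewrite -[a]intz scaler_int; case: a => n; first exact: Tn.
by rewrite NegzE mulrNz; apply: gen_symmetric => //; exact: Tn.
Qed.

Lemma gen_row_mul r m n (T : set 'rV[int]_r) (L : 'M[int]_(m, n))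
    (A : 'M[int]_(n, r)) :
  (forall y, T y -> T (- y)) -> (forall j, gen T (row j A)) ->
  forall i, gen T (row i (L *m A)).
Proof.
move=> TN TA i; rewrite row_mul mulmx_sum_row; apply: gen_sum => j.
exact: gen_scale.
Qed.

Local Notation toQ := (map_mx (intr : int -> rat)).

(** Writing [v] as [(v *m invmx A) *m A] shows that the [r] rows span the whole space of dimension
    [r], so they form a basis. *)
Lemma free_unitmx_rows (F : fieldType) r (A : 'M[F]_r) :
  A \in unitmx -> free [seq row i A | i <- enum 'I_r].
Proof.
move=> uA; apply: (@basis_free _ _ fullv); rewrite basisEdim.
rewrite size_map size_enum_ord dimvf [dim _]mul1n leqnn andbT.
apply/subvP => v _; rewrite -[v](mulmxKV uA) mulmx_sum_row.
apply: memv_suml => i _; apply/memvZ/memv_span/map_f.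
by rewrite mem_enum.
Qed.

Lemma dim_span_scale (F : fieldType) (vT : vectType F) (I : eqType)
    (s : seq I) (c : I -> F) (w : I -> vT) :
  free [seq w i | i <- s] -> (forall i, i \in s -> c i != 0) ->
  \dim <<[seq c i *: w i | i <- s]>> = size s.
Proof.
move=> /eqP; rewrite size_map => <- c0; congr (\dim _).
apply/eqP; rewrite eqEsubv.
apply/andP; split; apply/span_subvP => _ /mapP[i si ->].
  by apply/memvZ/memv_span/map_f.
rewrite -[w i](scalerK (c0 i si)); apply/memvZ/memv_span.
by apply/mapP; exists i.
Qed.

(** Neither the negatives of [B] nor the differences forming [gp] enlarge the span over [rat]. *)
Lemma rank_gen_symmetric r (B : seq 'rV[int]_r) :
  rank (gen [set` B ++ [seq - b | b <- B]]) = \dim <<[seq toQ b | b <- B]>>.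
Proof.
set T := [set` _]; have [T0 TD] := submonoid_gen T.
rewrite /rank; congr (\dim _); apply/eqP; rewrite eqEsubv; apply/andP; split.
  have TB x : gen T x -> toQ x \in <<[seq toQ b | b <- B]>>%VS.
    move: x; apply: gen_ind => [|x y Bx By|x].
    - by rewrite map_mx0 mem0v.
    - by rewrite map_mxD memvD.
    rewrite /T /= mem_cat => /orP[xB|/mapP[b bB ->]].
      exact/memv_span/map_f.
    by rewrite map_mxN memvN; exact/memv_span/map_f.
  apply/subvP => v /mem_span_set[s sT]; move: v.
  apply/subvP/span_subvP => u /sT.
  by move=> [z [x Tx [y Ty <-]] <-]; rewrite map_mxB memvB ?TB.
apply/span_subvP => _ /mapP[b bB ->]; apply/mem_span_set.
exists [:: toQ b]; last by rewrite memv_span ?mem_head.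
move=> u; rewrite /= inE => /eqP ->; exists b => //.
exists b; last by exists 0; rewrite ?subr0.
by apply: sub_gen_smallest; rewrite /T /= mem_cat bB.
Qed.

(** Put the generators in the rows of [A = L *m D *m R]. The nonzero rows of [D *m R] are multiples
    of distinct rows of [R], hence independent, and their number is the rank. *)
Lemma subgroup_basis r (s : seq 'rV[int]_r) :
    (forall x, gen [set` s] x -> gen [set` s] (- x)) ->
  exists2 B : seq 'rV[int]_r,
    gen [set` s] = gen [set` B ++ [seq - b | b <- B]] &
    size B = rank (gen [set` s]).
Proof.
set H := gen _ => HN.
pose A := \matrix_(i < size s) s`_i.
have [L uL [R uR [d _ AE]]] := int_Smith_normal_form A.
set D := (\matrix_(i, j) _) in AE.
(* Selects the nonzero diagonal entries of [D]; the bound by [size s] is explicit because the length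
   of [d] is not controlled. *)
pose p (i : 'I_r) := (i < size s)%N && (d`_i != 0).
pose J := filter p (enum 'I_r).
pose B := [seq d`_i *: row i R | i : 'I_r <- J].
have rowDR (i : 'I_(size s)) (j : 'I_r) : i = j :> nat ->
    row i (D *m R) = d`_j *: row j R.
  move=> ij; rewrite row_mul mulmx_sum_row (bigD1 j)//= !mxE ij eqxx mulr1n.
  rewrite big1 ?addr0// => k kj; rewrite !mxE ij.
  by rewrite eq_sym (negPf (kj : k != j :> nat)) mulr0n scale0r.
have rowDR0 (i : 'I_(size s)) : (r <= i)%N -> row i (D *m R) = 0.
  move=> ri; rewrite row_mul mulmx_sum_row big1// => k _; rewrite !mxE.
  by rewrite gtn_eqF ?mulr0n ?scale0r// (leq_trans (ltn_ord k)).
set T := [set` B ++ [seq - b | b <- B]].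
have TN x : T x -> T (- x).
  rewrite /T /= !mem_cat => /orP[xB|/mapP[b bB ->]].
    by rewrite map_f ?orbT.
  by rewrite opprK bB.
(* One inclusion reads off [A = L *m (D *m R)], the other [D *m R = invmx L *m A], both with integer
   coefficients. *)
have HT : H = gen T.
  apply/seteqP; split; apply: smallest_sub; try exact: submonoid_gen.
    move=> x /= xs; have ix : (index x s < size s)%N by rewrite index_mem.
    have -> : x = row (Ordinal ix) A by rewrite rowK /= nth_index.
    rewrite AE -mulmxA; apply: gen_row_mul => // i.
    have [T0 _] := submonoid_gen T.
    have [ri|ir] := leqP r i; first by rewrite rowDR0.
    rewrite (rowDR i (Ordinal ir))//=.
    have [->|di] := eqVneq d`_i 0; first by rewrite scale0r.
    apply: sub_gen_smallest; rewrite /T /= mem_cat; apply/orP; left.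
    apply/mapP; exists (Ordinal ir) => //.
    by rewrite mem_filter mem_enum /p /= ltn_ord di.
  have HB b : b \in B -> H b.
    move=> /mapP[i]; rewrite mem_filter => /andP[/andP[si _] _ ->].
    rewrite -(rowDR (Ordinal si))//.
    have -> : D *m R = invmx L *m A by rewrite AE -mulmxA mulKmx.
    (* [gen_row_mul] wants a symmetric generating set, which [s] need not be; so [H] is taken as its
       own generating set. *)
    have HH : gen H = H by apply: smallest_id; exact: submonoid_gen.
    rewrite -HH; apply: gen_row_mul => // j; rewrite HH.
    by apply: sub_gen_smallest; rewrite /= rowK mem_nth.
  move=> x; rewrite /T /= mem_cat => /orP[/HB//|/mapP[b /HB bB ->]].
  exact: HN.
exists B => //; rewrite HT rank_gen_symmetric.
have -> : [seq toQ b | b <- B] =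
    [seq (d`_i)%:~R *: row i (toQ R) | i : 'I_r <- J].
  by rewrite -map_comp; apply: eq_map => i; rewrite /= map_mxZ map_row.
rewrite dim_span_scale ?size_map//; last first.
  by move=> i; rewrite mem_filter intr_eq0 => /andP[/andP[]].
have uRQ : toQ R \in unitmx.
  by move: uR; rewrite !unitmxE det_map_mx; exact: rmorph_unit.
(* Permuting the rows of [R] so that those indexed by [J] come first exhibits them as a prefix of a
   free family. *)
have := free_unitmx_rows uRQ.
rewrite -(perm_free (perm_map _ (permEl (perm_filterC p _)))) map_cat.
exact: catl_free.
Qed.

(** * Assembling the generators *)

Theorem lemma3p3 (r : nat) (M : set 'rV[int]_r)
    (M_affine : affine M) (M_rank : rank M = r) :
  let r' := rank (units M) in
  exists (l : nat) (W : l.-tuple 'rV[int]_r),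
    [/\ (2 * r' <= l)%N,
        M = gen [set` W],
        gen [set` take (2 * r') W] = units M,
        (forall i : nat, (i < r')%N -> W`_i = - W`_(i + r')) &
        let V := gen [set` drop (2 * r') W] in
        positive V /\ V `\` [set 0] `<=` M `\` units M].
Proof.
move=> r'; have [_ [s Ms]] := M_affine.
pose inU x := `[< units M x >].
have seU : [set` s] `&` units M = [set` [seq x <- s | inU x]].
  by apply/seteqP; split=> x /=; rewrite mem_filter /inU;
    [case=> xs /asboolP->|case/andP=> /asboolP].
have seNU : [set` s] `\` units M = [set` [seq x <- s | ~~ inU x]].
  by apply/seteqP; split=> x /=; rewrite mem_filter /inU;
    [case=> xs /asboolPn->|case/andP=> /asboolPn].
have UE : units M = gen [set` [seq x <- s | inU x]].
  by rewrite -seU Ms -units_gen.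
have [|B UB sB] := @subgroup_basis r [seq x <- s | inU x].
  by rewrite -UE => x [Mx MNx]; split; rewrite ?opprK.
rewrite -UE in UB sB; rewrite -/r' in sB.
pose BB := B ++ [seq - b | b <- B].
have sBB : size BB = (2 * r')%N by rewrite size_cat size_map sB mul2n addnn.
(* The basis of the units, its negatives, then the non-unit members of [s]; the first two blocks
   have length [r'] each. *)
exists _, (in_tuple (BB ++ [seq x <- s | ~~ inU x])); split=> /=.
- by rewrite size_cat sBB leq_addr.
- apply/seteqP; split.
    rewrite [X in X `<=` _]Ms; apply: smallest_sub; first exact: submonoid_gen.
    move=> x /= xs; have [Ux|NUx] := boolP (inU x).
      have : units M x by exact/asboolP.
      rewrite UB; apply: sub_smallest2r; first exact: submonoid_gen.
      by move=> y /= yB; rewrite mem_cat yB.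
    by apply: sub_gen_smallest; rewrite /= mem_cat mem_filter NUx xs orbT.
  apply: smallest_sub => [|x /=]; first by rewrite Ms; exact: submonoid_gen.
  rewrite mem_cat => /orP[xB|]; last first.
    by rewrite mem_filter Ms => /andP[_ ?]; exact: sub_gen_smallest.
  suff [] : units M x by [].
  by rewrite UB; exact: sub_gen_smallest.
- by rewrite -sBB take_size_cat.
(* Index [i] falls in [B], and [i + r'] at position [i] of the negated copy. *)
- move=> i ir; rewrite !nth_cat sBB sB mul2n -addnn ltn_add2r ir.
  rewrite (leq_trans ir (leq_addr _ _)) ltnNge leq_addl addnK.
  by rewrite (nth_map 0) ?opprK// sB.
- rewrite -sBB drop_size_cat// -seNU.
  have VM : gen ([set` s] `\` units M) `\` [set 0] `<=` M `\` units M.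
    by rewrite Ms; exact: gen_nonunits.
  by split=> //; apply: positive_sub_nonunits VM; exact: submonoid_gen.
Qed.
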